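(* A partition $P$ is self-conjugate if and only if there exist an integer $n\ge 0$ and positive integers $x_0,x_1,\dots,x_n$ such that $P$ can be written as $$P = Y_n+Y_{n-1}+\cdots+Y_0,$$ where, for each $0\le k\le n$, $Y_{n-k}$ is the partition having exactly $x_k$ parts, all of them equal to $\sum_{i=0}^{n-k}x_i$; that is, $$P=\Big[\underbrace{\textstyle\sum_{i=0}^{n}x_i,\dots,\sum_{i=0}^{n}x_i}_{x_0\text{ parts}},\ \underbrace{\textstyle\sum_{i=0}^{n-1}x_i,\dots,\sum_{i=0}^{n-1}x_i}_{x_1\text{ parts}},\ \dots,\ \underbrace{\textstyle\sum_{i=0}^{0}x_i,\dots,\sum_{i=0}^{0}x_i}_{x_n\text{ parts}}\Big],$$ so that $P$ has $\sum_{i=0}^{n}x_i$ parts in total.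
   Context: A partition of a positive integer $N$ is a sequence $P=[y_0,y_1,\dots,y_m]$ ($m\ge 0$) of positive integers with $y_0+\cdots+y_m=N$ and $y_i\ge y_{i+1}$ for all $0\le i<m$; the $y_i$ are called the parts of $P$. The sum $P+Q$ of two partitions is the partition obtained by combining the parts of $P$ and of $Q$ (with multiplicity) into one sequence, reordered to be non-increasing. The conjugate $P'$ of $P$ is the partition obtained by interchanging the rows and columns of the Young diagram of $P$: it has $y_0$ parts, and its $j$-th part ($1\le j\le y_0$) is the number of indices $i$ with $y_i\ge j$. $P$ is self-conjugate if $P=P'$. *)

(* Defs.v *)
From mathcomp Require Import all_boot.

Set Implicit Arguments.
Unset Strict Implicit.
Unset Printing Implicit Defensive.

Definition is_partition_of (N : nat) (P : seq nat) : bool :=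
  [&& 0 < N, all (leq 1) P, sorted geq P & sumn P == N].

Definition partition_sum (P Q : seq nat) : seq nat := sort geq (P ++ Q).

(* The entry at index j (counted from 0) is the number of parts >= j + 1. *)
Definition conjugate (P : seq nat) : seq nat :=
  mkseq (fun j => count (leq j.+1) P) (head 0 P).

Definition self_conjugate (P : seq nat) : Prop := P = conjugate P.

(* The block Y_(n-k): x_k parts, all equal to x_0 + ... + x_(n-k).  Only the
   values x_0, ..., x_n of x are used when k <= n. *)
Definition block (n : nat) (x : nat -> nat) (k : nat) : seq nat :=
  nseq (x k) (\sum_(0 <= i < (n - k).+1) x i).

(* Y_n + Y_(n-1) + ... + Y_0.  The empty sequence is not a partition of a
   positive integer; it only serves as the neutral element of the sum. *)
Definition block_sum (n : nat) (x : nat -> nat) : seq nat :=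
  \big[partition_sum/[::]]_(0 <= k < n.+1) block n x k.

(* Main.v *)
(** Write [P] in run-length form, with multiplicities [x_0, ..., x_(n-1)] and
    strictly decreasing values [v_0 > ... > v_(n-1) > v_n = 0].  Then the
    run-length form of [P'] has multiplicities [v_(n-1-k) - v_(n-k)] and values
    [x_0 + ... + x_(n-1-k)].  If [P = P'], the strictly decreasing sequences of
    values have the same members, hence [v_k = x_0 + ... + x_(n-1-k)];
    conversely this equality makes the two run-length forms coincide. *)

Require Import Defs.
From mathcomp Require Import all_boot zify.

Set Implicit Arguments.
Unset Strict Implicit.
Unset Printing Implicit Defensive.

(** Total functions instead of lists of pairs: dropping the first run is a mere shift of [x] and
    [v], and the final value [v n = 0] has a place. *)
Definition runs (n : nat) (x v : nat -> nat) : seq nat :=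
  flatten (mkseq (fun k => nseq (x k) (v k)) n).

Definition psum (x : nat -> nat) (n : nat) : nat := \sum_(0 <= i < n) x i.

Lemma psum0 x : psum x 0 = 0.
Proof. by rewrite /psum big_nil. Qed.

Lemma psumS x n : psum x n.+1 = psum x n + x n.
Proof. by rewrite /psum big_nat_recr. Qed.

Lemma psum_recl x n : psum x n.+1 = x 0 + psum (fun k => x k.+1) n.
Proof. by rewrite /psum big_nat_recl. Qed.

Lemma leq_psum x m n : m <= n -> psum x m <= psum x n.
Proof. by apply: (homo_leq leqnn leq_trans) => k; rewrite psumS leq_addr. Qed.

Lemma runsS n x v :
  runs n.+1 x v = nseq (x 0) (v 0) ++ runs n (fun k => x k.+1) (fun k => v k.+1).
Proof. by rewrite /runs /mkseq -add1n iotaD /= (iotaDl 1 0) -map_comp. Qed.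

Lemma runsSr n x v : runs n.+1 x v = runs n x v ++ nseq (x n) (v n).
Proof.
by rewrite /runs /mkseq -addn1 iotaD map_cat flatten_cat /= add0n cats0.
Qed.

Lemma eq_runs n x y v w :
  (forall k, k < n -> x k = y k) -> (forall k, k < n -> v k = w k) ->
  runs n x v = runs n y w.
Proof.
move=> exy evw; congr flatten; apply/eq_in_map => k.
by rewrite mem_iota add0n => /= lt_kn; rewrite exy ?evw.
Qed.

Lemma map_runs f n x v : map f (runs n x v) = runs n x (fun k => f (v k)).
Proof.
rewrite /runs map_flatten -map_comp; congr flatten.
by apply: eq_map => k /=; rewrite map_nseq.
Qed.

Lemma size_runs n x v : size (runs n x v) = psum x n.
Proof.
elim: n => [|n IHn]; first by rewrite psum0.
by rewrite runsSr size_cat size_nseq IHn psumS.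
Qed.

Lemma mem_runs n x v : (forall k, k < n -> 0 < x k) -> runs n x v =i mkseq v n.
Proof.
move=> x_gt0 a; apply/flatten_mapP/mapP => -[k].
  by move=> kn; rewrite mem_nseq => /andP[_ /eqP->]; exists k.
rewrite mem_iota add0n => /= lt_kn ->; exists k; first by rewrite mem_iota.
by rewrite mem_nseq x_gt0 ?eqxx.
Qed.

Lemma runs_le n x v a :
  (forall k, k < n -> v k.+1 <= v k) -> v 0 <= a -> all (geq a) (runs n x v).
Proof.
elim: n x v a => [|n IHn] x v a // v_dec le_va.
rewrite runsS all_cat all_nseq /= le_va orbT /=.
by apply: IHn => [k lt_kn|]; [apply: v_dec | apply: leq_trans le_va; apply: v_dec].
Qed.

Lemma runs_sorted n x v :
  (forall k, k < n -> v k.+1 <= v k) -> sorted geq (runs n x v).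
Proof.
have geq_trans : transitive geq by move=> b a c /= ba cb; apply: leq_trans ba.
rewrite sorted_pairwise //; elim: n x v => [|n IHn] x v // v_dec.
rewrite runsS pairwise_cat IHn ?andbT; last by move=> k lt_kn; apply: v_dec.
apply/andP; split.
  apply/allrelP => a b; rewrite mem_nseq => /andP[_ /eqP->] /=.
  have /allP H := @runs_le n (fun k => x k.+1) (fun k => v k.+1) (v 0)
    (fun k lt_kn => v_dec k.+1 lt_kn) (v_dec 0 isT).
  by move/H.
elim: (x 0) => //= m ->; rewrite andbT.
by apply/allP => b; rewrite mem_nseq => /andP[_ /eqP->] /=.
Qed.

Lemma head_runs n x v :
  (forall k, k < n -> 0 < x k) -> v n = 0 -> head 0 (runs n x v) = v 0.
Proof.
(* With no runs the head is the default 0, which [v n = 0] identifies with [v 0]. *)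
case: n => [|n] x_gt0 vn0; first by rewrite vn0.
by rewrite runsS; move: (x_gt0 0 isT); case: (x 0).
Qed.

(** Placing [a] rows of length [b] on top of the diagram of [Q] lengthens each column of [Q] by [a]
    and creates [b - head 0 Q] further columns of height [a]. *)
Lemma conjugate_cat_nseq a b Q : 0 < a -> all (geq (head 0 Q)) Q -> head 0 Q <= b ->
  conjugate (nseq a b ++ Q) =
    map (addn a) (conjugate Q) ++ nseq (b - head 0 Q) a.
Proof.
move=> a_gt0 leQ le_hb; rewrite /conjugate /mkseq.
have -> : head 0 (nseq a b ++ Q) = b by case: a a_gt0.
rewrite -[in LHS](subnKC le_hb) iotaD map_cat -map_comp add0n; congr (_ ++ _).
  apply/eq_in_map => j; rewrite mem_iota add0n => /= lt_jh.
  by rewrite count_cat count_nseq (subnKC le_hb) (leq_trans lt_jh) ?mul1n.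
set s := [seq _ | j <- _]; have -> : b - head 0 Q = size s.
  by rewrite size_map size_iota.
apply/all_pred1P/allP => _ /mapP[j + ->] /=.
rewrite mem_iota (subnKC le_hb) => /andP[le_hj lt_jb].
(* Beyond column [head 0 Q] no part of [Q] contributes. *)
rewrite count_cat count_nseq lt_jb mul1n -[X in _ == X]addn0 eqn_add2l.
rewrite -leqn0 leqNgt -has_count; apply/hasPn => c.
by move=> /(allP leQ) /= le_ch; rewrite -ltnNge ltnS (leq_trans le_ch).
Qed.

Lemma conjugate_runs n x v :
  (forall k, k < n -> 0 < x k) -> (forall k, k < n -> v k.+1 <= v k) ->
  v n = 0 ->
  conjugate (runs n x v) =
    runs n (fun k => v (n - k.+1) - v (n - k)) (fun k => psum x (n - k)).
Proof.
elim: n x v => [|n IHn] x v // x_gt0 v_dec vn0.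
have x'_gt0 k : k < n -> 0 < x k.+1 by move=> ?; apply: x_gt0.
have v'_dec k : k < n -> v k.+2 <= v k.+1 by move=> ?; apply: v_dec.
rewrite runsS conjugate_cat_nseq ?x_gt0 ?head_runs ?v_dec ?runs_le //.
(* The first run of the partition yields the last run of the conjugate, [v 0 - v 1] copies of [x 0];
   adding [x 0] to the other values completes their partial sums. *)
rewrite IHn // map_runs runsSr subnn subSnn psumS psum0 add0n.
congr (_ ++ _); apply: eq_runs => k lt_kn.
  by rewrite -!subSn // 1?ltnW.
by rewrite (subSn (ltnW lt_kn)) psum_recl.
Qed.

Lemma runs_exist P : all (leq 1) P -> sorted geq P ->
  exists n x v, [/\ P = runs n x v, forall k, k < n -> 0 < x k,
                    forall k, k < n -> v k.+1 < v k & v n = 0].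
Proof.
elim: P => [|a P IHP] /=; first by exists 0, (fun=> 0), (fun=> 0).
move=> /andP[a_gt0 P_gt0] aP.
have [n [x [v [defP x_gt0 v_dec vn0]]]] := IHP P_gt0 (path_sorted aP).
have le_va : v 0 <= a.
  rewrite -(head_runs x_gt0 vn0) -defP.
  by case: (P) aP => //= b s /andP[].
(* The new part either lengthens the first run or opens a run of multiplicity 1. *)
have [eq_va | ne_va] := eqVneq (v 0) a.
  case: n => [|n] in defP x_gt0 v_dec vn0 *.
    by rewrite -eq_va vn0 in a_gt0.
  exists n.+1, (fun k => if k is 0 then (x 0).+1 else x k), v; split => //.
    by rewrite defP !runsS /= eq_va.
  by case=> // k; apply: x_gt0.
exists n.+1, (fun k => if k is k'.+1 then x k' else 1),
  (fun k => if k is k'.+1 then v k' else a); split => //.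
- by rewrite runsS /= defP.
- by case=> // k; apply: x_gt0.
- by case=> [_|k]; [rewrite ltn_neqAle ne_va | apply: v_dec].
Qed.

Lemma mkseq_gtn_sorted n v :
  (forall k, k.+1 < n -> v k.+1 < v k) -> sorted gtn (mkseq v n).
Proof.
move=> v_dec; apply/(sortedP 0) => k; rewrite size_mkseq => lt_kn.
by rewrite !nth_mkseq ?(ltnW lt_kn) //=; apply: v_dec.
Qed.

Lemma self_conjugate_runs n x v :
  (forall k, k < n -> 0 < x k) -> (forall k, k < n -> v k.+1 < v k) ->
  v n = 0 ->
  self_conjugate (runs n x v) <-> (forall k, k < n -> v k = psum x (n - k)).
Proof.
move=> x_gt0 v_dec vn0.
rewrite /self_conjugate conjugate_runs //; last by move=> k /v_dec/ltnW.
split=> [eq_runs_vx k lt_kn | eq_vx].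
  (* Strictly decreasing lists with the same members are equal, so multiplicities need not be
     compared. *)
  suff /(congr1 (nth 0 ^~ k)) : mkseq v n = mkseq (fun k => psum x (n - k)) n.
    by rewrite !nth_mkseq.
  apply: (@irr_sorted_eq _ gtn) => [b a c /= ba cb | a /= |||].
  - exact: ltn_trans cb ba.
  - exact: ltnn.
  - by apply: mkseq_gtn_sorted => i lt_in; apply: v_dec; apply: ltnW.
  - apply: mkseq_gtn_sorted => i lt_in.
    rewrite -(subSS i) (subSn (ltnW lt_in)) psumS -addn1 leq_add2l x_gt0 //; lia.
  (* Strict decrease of [v] makes every run of the conjugate nonempty, so all its values occur. *)
  - move=> a; rewrite -(mem_runs v x_gt0) eq_runs_vx mem_runs // => i lt_in.
    have := v_dec (n - i.+1); rewrite -subSn // subSS subn_gt0; apply; lia.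
(* The case [k = n] is included because the first multiplicity of the conjugate involves [v n]. *)
have eq_vx' k : k <= n -> v k = psum x (n - k).
  rewrite leq_eqVlt => /predU1P[->|/eq_vx //].
  by rewrite vn0 subnn psum0.
apply: eq_runs => // k lt_kn.
by rewrite !eq_vx' ?leq_subr // !subKn // 1?ltnW // psumS addKn.
Qed.

(** Every tail of a sorted concatenation is sorted, so each [sort] in the iterated sum acts as the
    identity. *)
Lemma big_partition_sum (s : seq nat) (F : nat -> seq nat) :
  sorted geq (flatten (map F s)) ->
  \big[partition_sum/[::]]_(k <- s) F k = flatten (map F s).
Proof.
have geq_trans : transitive geq by move=> b a c /= ba cb; apply: leq_trans ba.
elim: s => [|k s IHs]; first by rewrite big_nil.
rewrite big_cons /= => sorted_Fks; rewrite IHs.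
  exact: sorted_sort.
by move: sorted_Fks; rewrite !sorted_pairwise // pairwise_cat => /and3P[].
Qed.

Lemma flatten_block n x :
  flatten [seq block n x k | k <- iota 0 n.+1] =
    runs n.+1 x (fun k => psum x (n.+1 - k)).
Proof.
congr flatten; apply/eq_in_map => k; rewrite mem_iota add0n => /= le_kn.
by rewrite /block /psum subSn.
Qed.

Lemma block_sum_flatten n x :
  block_sum n x = flatten [seq block n x k | k <- iota 0 n.+1].
Proof.
rewrite /block_sum /index_iota subn0 big_partition_sum // flatten_block.
by apply: runs_sorted => k _; apply: leq_psum; apply: leq_sub2l.
Qed.

Theorem theorem6p1 :
  (forall (N : nat) (P : seq nat), is_partition_of N P ->
     (self_conjugate P <->
      exists (n : nat) (x : nat -> nat),
        (forall k : nat, k <= n -> 0 < x k) /\ P = block_sum n x)) /\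
  (forall (n : nat) (x : nat -> nat), (forall k : nat, k <= n -> 0 < x k) ->
     block_sum n x = flatten [seq block n x k | k <- iota 0 n.+1] /\
     size (block_sum n x) = \sum_(0 <= i < n.+1) x i).
Proof.
split=> [N P /and4P[N_gt0 P_gt0 sortedP /eqP sumP] | n x x_gt0]; last first.
  by rewrite block_sum_flatten flatten_block size_runs.
split=> [selfP | [n [x [x_gt0 ->]]]].
  have [n [x [v [defP x_gt0 v_dec vn0]]]] := runs_exist P_gt0 sortedP.
  (* Zero runs would make [P] empty, against [0 < N]; hence the last index [n] of the blocks
     exists. *)
  case: n => [|n] in defP x_gt0 v_dec vn0 *.
    by rewrite -sumP defP in N_gt0.
  exists n, x; split=> //; rewrite block_sum_flatten flatten_block defP.
  apply: eq_runs => // k; apply/self_conjugate_runs: k => //.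
  by rewrite -defP.
rewrite block_sum_flatten flatten_block; apply/self_conjugate_runs => //.
  (* Consecutive block values differ by [x (n - k)], which is positive. *)
  move=> k le_kn; rewrite subSS (subSn (le_kn : k <= n)) psumS.
  by rewrite -addn1 leq_add2l x_gt0 ?leq_subr.
by rewrite subnn psum0.
Qed.
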